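(* Let $Q$ be a quadrangulation with vertices properly colored black and white, and let $s_0,s_1$ be the two black vertices on its outer face. Then the strong labelings of $Q$ (with these special vertices) are in bijection with the separating decompositions of $Q$ with sinks $s_0,s_1$.
   Context: A quadrangulation is a simple plane graph with at least four vertices all of whose faces (including the outer face) are bounded by $4$-cycles. An angle is an incidence of a vertex with a face. A strong labeling of $Q$ is a map from the angles of $Q$ to $\{0,1\}$ such that: (G0) all angles at $s_i$ are labeled $i$; (G1) for each vertex $v\notin\{s_0,s_1\}$ the labels around $v$ form one non-empty cyclic interval of $1$s and one non-empty cyclic interval of $0$s; (G2) for each edge, the two labels on the two sides of the edge coincide at one endpoint and differ at the other; (G3) the labels in each bounded face, read cyclically, are $0,0,1,1$, and reading the labels of the outer face in clockwise order starting at $s_0$ they are $0,0,1,1$. A separating decomposition of $Q$ is a partition of its edge set into two directed trees $T_0,T_1$ with sinks $s_0,s_1$ respectively (all edges of $T_i$ oriented towards $s_i$), such that at each vertex other than $s_0,s_1$ the incident edges appear, in clockwise order for black vertices and counterclockwise order for white vertices, as: the incoming edges (if any) of $T_0$, then the outgoing edge of $T_0$, then the incoming edges (if any) of $T_1$, then the outgoing edge of $T_1$. *)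

(* Defs.v *)
(* Plane graphs are encoded as combinatorial maps (rotation systems). *)
From HB Require Import structures.
From mathcomp Require Import all_boot fingroup perm.
Set Implicit Arguments. Unset Strict Implicit. Unset Printing Implicit Defensive.

Section PlaneMaps.
(* D = darts (half-edges), V = vertices.
   alpha d  = the opposite dart of the same edge,
   sigma d  = the next dart CLOCKWISE around the tail vertex of d,
   tail d   = the vertex at which d starts.
   An angle (corner) is represented by the dart d: it is the corner at tail d
   between d and sigma d.  Faces are the orbits of phi = alpha \o sigma; the
   corners of a face in phi-order go counterclockwise around bounded faces and
   clockwise around the outer face. *)
Variables (D V : finType) (alpha : D -> D) (sigma : {perm D}) (tail : D -> V).

Definition head (d : D) : V := tail (alpha d).
Definition phi (d : D) : D := alpha (sigma d).

Definition map_rel : rel D := fun x y => (y == alpha x) || (y == sigma x).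

(* connected combinatorial map of genus 0 (Euler: V - E + F = 2, E = #|D|/2) *)
Definition plane_map : Prop :=
  [/\ involutive alpha /\ (forall d, alpha d != d),
      (forall d e, (tail d == tail e) = fconnect sigma d e),
      (forall v, exists d, tail d = v),
      (forall d e, connect map_rel d e) &
      #|V| + fcard phi D = (#|D|)./2 + 2].

Definition simple_map : Prop :=
  (forall d, tail d != head d) /\
  (forall d e, tail d = tail e -> head d = head e -> d = e).

Definition quadrangulation : Prop :=
  [/\ plane_map, simple_map, 4 <= #|V| &
      forall d, fingraph.order phi d = 4 /\ uniq [seq tail x | x <- orbit phi d]].

(* col v = true means v is black *)
Definition proper_coloring (col : V -> bool) : Prop :=
  forall d, col (tail d) != col (head d).

(* the outer face is the phi-orbit of the dart o *)
Definition on_face (o : D) (v : V) : Prop :=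
  exists e, fconnect phi o e /\ tail e = v.

Definition face_labels (L : D -> bool) (e : D) : seq bool :=
  [seq L (iter i phi e) | i <- iota 0 4].

(* Labels in {0,1} are encoded as bool: false = 0, true = 1. *)
Definition strong_labeling (o : D) (s0 s1 : V) (L : D -> bool) : Prop :=
  [/\
      (forall d, tail d = s0 -> L d = false) /\ (forall d, tail d = s1 -> L d = true),
      (forall v, v != s0 -> v != s1 ->
         exists d k, [/\ tail d = v, 0 < k < fingraph.order sigma d &
                        forall i, i < fingraph.order sigma d -> L (iter i sigma d) = (i < k)]),
      (* G2: the two angles beside edge {d, alpha d} at tail d are d and sigma^-1 d *)
      (forall d, (L d == L ((sigma^-1)%g d)) != (L (alpha d) == L ((sigma^-1)%g (alpha d)))),
      (forall d, ~~ fconnect phi o d ->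
         exists e, fconnect phi d e /\ face_labels L e = [:: false; false; true; true]) &
      (* G3, outer face read clockwise starting at s0 *)
      (exists e, [/\ fconnect phi o e, tail e = s0 &
                     face_labels L e = [:: false; false; true; true]])].

(* An oriented sub-edge-set: darts d with inT d (closed under alpha); the edge of
   d is oriented from tail d to head d iff out d.  It is a directed tree with
   sink s (an in-arborescence rooted at s): s is a vertex of it, s has no
   outgoing arc, every other vertex of it has exactly one outgoing arc, and
   every vertex of it has a directed path to s. *)
Definition tree_arc (inT out : D -> bool) : rel V :=
  fun x y => [exists d, [&& inT d, out d, tail d == x & head d == y]].

Definition directed_tree (inT out : D -> bool) (s : V) : Prop :=
  [/\ exists d, inT d /\ tail d = s,
      (forall d, inT d -> tail d = s -> ~~ out d),
      (forall v, v != s -> (exists d, inT d /\ tail d = v) ->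
          #|[set d | [&& inT d, out d & tail d == v]]| = 1) &
      (forall v, (exists d, inT d /\ tail d = v) -> connect (tree_arc inT out) v s)].

(* A separating decomposition encoded by c d (false: the edge of d is in T0,
   true: in T1) and out d (the edge of d is oriented away from tail d). *)
Definition dart_type (c out : D -> bool) (d : D) : nat := (2 * c d + out d)%N.

Definition separating_decomposition (col : V -> bool) (s0 s1 : V)
    (c out : D -> bool) : Prop :=
  [/\ (forall d, c (alpha d) = c d /\ out (alpha d) = ~~ out d),
      directed_tree (fun d => ~~ c d) out s0,
      directed_tree c out s1 &
      (forall v, v != s0 -> v != s1 ->
         let rot := if col v then (sigma : D -> D) else (sigma^-1)%g in
         exists d a b, tail d = v /\
           [seq dart_type c out (iter k rot d) | k <- iota 0 (fingraph.order sigma d)]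
             = nseq a 0 ++ 1 :: nseq b 2 ++ [:: 3])].

End PlaneMaps.

(* Main.v *)
(* Write [turn] for the rotation that turns clockwise at black and counter-
   clockwise at white vertices.  Rules G2 and G3 say precisely that the label is
   kept when passing along a face from a black to a white corner and flipped
   from white to black.  Reading, for each dart [d], the label of the corner just
   before [d] in the [turn]-order then gives a well-defined color [c] of the edge,
   and the edge leaves [tail d] iff [c d] differs from [c (turn d)].  In these
   terms G1 and the local rule of a separating decomposition are both "exactly
   one change from 0 to 1 around each ordinary vertex".

   From decompositions to labelings, one only has to see that [s0] and [s1]
   have no outgoing edges, which follows from the edge count 2|V| - 4.

   From labelings to decompositions, one has to exclude monochromatic directed
   cycles.  Such a cycle bounds a set of faces missing the outer face (first
   homology over F_2 vanishes, by Euler's formula and a rank count).  Along the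
   cycle, the outgoing edges of the other color alternate between the two sides,
   so one of them enters the region; the path of the other color that
   continues it cannot leave, hence closes up to a cycle bounding a strictly
   smaller region: infinite descent. *)
Require Import Defs.
From HB Require Import structures.
From mathcomp Require Import all_boot fingroup perm.
From mathcomp Require Import ssralg zmodp matrix mxalgebra zify.
From Stdlib Require Import ProofIrrelevance.

Set Implicit Arguments. Unset Strict Implicit. Unset Printing Implicit Defensive.
Import GRing.Theory.

(** * Linear algebra: exactness of a three-term complex from a dimension count *)

Section Exactness.
Local Open Scope ring_scope.
Variable K : fieldType.

Lemma sum_enum_val (T : finType) (h : T -> K) :
  \sum_(i < #|T|) h (enum_val i) = \sum_t h t.
Proof.
by rewrite (reindex (@enum_val T T)) //; apply: onW_bij; apply: enum_val_bij.
Qed.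

(** The left kernel lies in the line of constant rows, so rank-nullity gives the bound. *)
Lemma rank_ker_constant (E F : finType) (a : F -> E -> K) :
  (forall x : F -> K, (forall e, \sum_f x f * a f e = 0) ->
     forall f f', x f = x f') ->
  (#|F| <= (\rank (\matrix_(i < #|F|, j < #|E|) a (enum_val i) (enum_val j))).+1)%N.
Proof.
set A := (X in \rank X) => ha; suff: (\rank (kermx A) <= 1)%N by rewrite mxrank_ker leq_subLR addn1.
suff kerA : (kermx A <= (const_mx 1 : 'rV_#|F|))%MS.
  by rewrite (leq_trans (mxrankS kerA)) ?rank_leq_row.
apply/row_subP => i; set u := row i _.
have uA : u *m A = 0 by apply/eqP; rewrite -sub_kermx row_sub.
have uc (f f' : F) : u 0 (enum_rank f) = u 0 (enum_rank f').
  apply: (ha (fun f => u 0 (enum_rank f))) => e.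
  have := congr1 (fun M : 'rV_#|E| => M 0 (enum_rank e)) uA.
  rewrite !mxE => s0; rewrite -[RHS]s0 -sum_enum_val; apply: eq_bigr => j _.
  by rewrite enum_valK !mxE enum_rankK.
have [F0|] := posnP #|F|.
  have -> : u = 0 by apply/rowP => j; have := ltn_ord j; rewrite {2}F0.
  exact: sub0mx.
case/card_gt0P => f0 _; apply/sub_rVP; exists (u 0 (enum_rank f0)).
apply/rowP => j; rewrite -[j]enum_valK (uc _ f0).
by rewrite [in RHS]mxE [in X in _ * X]mxE mulr1.
Qed.

(* Rank count: both constant kernels make the rank of [a] at least [F - 1] and
   that of [b] at least [V - 1], so the image of [a] fills the kernel of [b]. *)
Lemma exact_of_euler (V E F : finType) (a : F -> E -> K) (b : E -> V -> K) :
  (forall f v, \sum_e a f e * b e v = 0) ->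
  (forall x : F -> K, (forall e, \sum_f x f * a f e = 0) ->
     forall f f', x f = x f') ->
  (forall y : V -> K, (forall e, \sum_v y v * b e v = 0) ->
     forall v v', y v = y v') ->
  (#|E| + 2 <= #|V| + #|F|)%N ->
  forall u : E -> K, (forall v, \sum_e u e * b e v = 0) ->
  exists x : F -> K, forall e, u e = \sum_f x f * a f e.
Proof.
move=> ab0 ka kb euler u ub0.
pose A := \matrix_(i < #|F|, j < #|E|) a (enum_val i) (enum_val j).
pose B := \matrix_(i < #|E|, j < #|V|) b (enum_val i) (enum_val j).
have rA := rank_ker_constant ka; rewrite -/A in rA.
have rB : (#|V| <= (\rank B).+1)%N.
  rewrite -mxrank_tr (leq_trans (rank_ker_constant kb)) //= ltnS.
  by rewrite (_ : \matrix_(_, _) _ = B^T) //; apply/matrixP => i j; rewrite !mxE.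
have sAB : (A <= kermx B)%MS.
  apply/sub_kermxP/matrixP => i j; rewrite !mxE -[RHS](ab0 (enum_val i) (enum_val j)).
  by rewrite -[RHS]sum_enum_val; apply: eq_bigr => k _; rewrite !mxE.
have sBA : (kermx B <= A)%MS.
  rewrite -(mxrank_leqif_sup sAB) mxrank_ker eqn_leq -mxrank_ker mxrankS //=.
  rewrite mxrank_ker leq_subLR -(leq_add2r 2) (leq_trans euler) //.
  by rewrite addn2 -addnS -addSn leq_add.
pose w := \row_(j < #|E|) u (enum_val j).
have /submxP[x xw] : (w <= A)%MS.
  apply: submx_trans sBA; apply/sub_kermxP/rowP => j; rewrite !mxE -[RHS](ub0 (enum_val j)).
  by rewrite -[RHS]sum_enum_val; apply: eq_bigr => k _; rewrite !mxE.
exists (fun f => x 0 (enum_rank f)) => e.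
have := congr1 (fun M : 'rV_#|E| => M 0 (enum_rank e)) xw.
rewrite !mxE enum_rankK => ->; rewrite -[RHS]sum_enum_val; apply: eq_bigr => j _.
by rewrite !mxE enum_valK enum_rankK.
Qed.
End Exactness.

(** * Cellular chains over F_2 on a plane map *)

Section Homology.
Local Open Scope ring_scope.
Variables (D V : finType) (alpha : D -> D) (sigma : {perm D}) (tail : D -> V).
Hypothesis planeM : plane_map alpha sigma tail.
Local Notation phi := (Defs.phi alpha sigma).
Local Notation head := (Defs.head alpha tail).

Lemma alphaK : involutive alpha. Proof. by case: planeM => -[]. Qed.

Lemma phi_inj : injective phi.
Proof. by move=> x y; rewrite /Defs.phi => /(can_inj alphaK); apply: perm_inj. Qed.

Lemma tail_sigma d : tail (sigma d) = tail d.
Proof. by case: planeM => _ h *; apply/esym/eqP; rewrite h fconnect1. Qed.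

Lemma tail_sigmaV d : tail ((sigma^-1)%g d) = tail d.
Proof. by rewrite -{2}[d](permKV sigma) tail_sigma. Qed.

Lemma map_invariant (T : eqType) (g : D -> T) :
  (forall d, g (alpha d) = g d) -> (forall d, g (sigma d) = g d) ->
  forall d e, g d = g e.
Proof.
move=> ga gs d e; case: planeM => _ _ _ /(_ d e) /connectP[p + ->] _.
by elim: p d => //= x p IH d /andP[/orP[]/eqP ->{x} /IH <-].
Qed.

(** An arbitrary choice of one dart per edge, by position in the enumeration. *)
Definition edge_rep d := (enum_rank d < enum_rank (alpha d))%N.

Lemma edge_repN d : edge_rep (alpha d) = ~~ edge_rep d.
Proof.
rewrite /edge_rep alphaK -leqNgt ltn_neqAle; case: eqP => //=.
move/val_inj/enum_rank_inj => dd; case: planeM => -[_ /(_ d)].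
by rewrite dd eqxx.
Qed.

Lemma sum_edges (R : nmodType) (g : D -> R) :
  \sum_(e : {d | edge_rep d}) (g (val e) + g (alpha (val e))) = \sum_d g d.
Proof.
rewrite big_split /= [RHS](bigID edge_rep) /=; congr (_ + _).
  by rewrite [RHS]big_sub.
rewrite [RHS](reindex_inj (can_inj alphaK)) /=.
under [RHS]eq_bigl => d do rewrite edge_repN negbK.
by rewrite [RHS]big_sub.
Qed.

Lemma card_edges : #|{: {d | edge_rep d}}| = #|D|./2.
Proof.
rewrite card_sig -(cardC [pred d | edge_rep d]).
suff <- : #|[pred d | edge_rep d]| = #|predC [pred d | edge_rep d]|.
  by rewrite addnn doubleK.
rewrite -(card_image (can_inj alphaK)); apply: eq_card => d.
by rewrite -{1}[d]alphaK (mem_image (can_inj alphaK)) !inE edge_repN.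
Qed.

Definition face_rep d : {d | froots phi d} :=
  exist _ (froot phi d) (roots_root (fconnect_sym phi_inj) d).

Lemma face_repP d e : fconnect phi d e -> face_rep d = face_rep e.
Proof.
by move=> de; apply/val_inj/eqP => /=; rewrite root_connect //; apply: fconnect_sym phi_inj.
Qed.

Lemma face_rep_id f : face_rep (val f) = f.
Proof. by apply/val_inj/eqP => /=; exact: (valP f). Qed.

(** One [phi]-step leads from [sigma^-1 (alpha d)] to [d]. So the faces of [d] and [sigma^-1 d] are
    the two sides of the edge, whichever of its darts is used. *)
Lemma face_rep_sigmaV_alpha d : face_rep ((sigma^-1)%g (alpha d)) = face_rep d.
Proof.
apply: face_repP; rewrite -[X in fconnect _ _ X]alphaK -[alpha d](permKV sigma).
by rewrite permK; exact: fconnect1.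
Qed.

Lemma sum_delta (T : finType) (x : T -> 'F_2) t : \sum_s x s * (t == s)%:R = x t.
Proof.
rewrite (bigD1 t) //= eqxx mulr1 big1 ?addr0 // => s /negPf.
by rewrite eq_sym => ->; rewrite mulr0.
Qed.

Lemma F2_addrr (x : 'F_2) : x + x = 0.
Proof. by apply/val_inj; case: x => -[|[|]]. Qed.

Lemma F2_add_eq0 (x y : 'F_2) : x + y = 0 -> x = y.
Proof. by move=> xy0; rewrite -[x]addr0 -(F2_addrr y) addrA xy0 add0r. Qed.

(* First homology with coefficients in F_2 vanishes. *)
Lemma plane_cycle_bounds (A : D -> bool) :
  (forall d, A (alpha d) = A d) ->
  (forall v, ~~ odd #|[set d | (tail d == v) && A d]|) ->
  exists S : D -> bool, (forall d, S (phi d) = S d) /\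
    (forall d, A d = S d (+) S ((sigma^-1)%g d)).
Proof.
move=> Aa Aev.
(* [a] and [b] are the boundary maps from faces to edges and from edges to vertices. *)
pose a (f : {d | froots phi d}) (e : {d | edge_rep d}) : 'F_2 :=
  (face_rep (val e) == f)%:R + (face_rep ((sigma^-1)%g (val e)) == f)%:R.
pose b (e : {d | edge_rep d}) v : 'F_2 := (tail (val e) == v)%:R + (head (val e) == v)%:R.
have xa x e : \sum_f x f * a f e = x (face_rep (val e)) + x (face_rep ((sigma^-1)%g (val e))).
  by under eq_bigr => f _ do rewrite mulrDr; rewrite big_split /= !sum_delta.
have yb y e : \sum_v y v * b e v = y (tail (val e)) + y (head (val e)).
  by under eq_bigr => f _ do rewrite mulrDr; rewrite big_split /= !sum_delta.
have face_alpha d : face_rep (alpha d) = face_rep ((sigma^-1)%g d).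
  by rewrite -face_rep_sigmaV_alpha alphaK.
have on_edges (P : D -> Prop) : (forall d, P (alpha d) -> P d) ->
    (forall e : {d | edge_rep d}, P (val e)) -> forall d, P d.
  move=> Pa Pe d; have [de|] := boolP (edge_rep d); first exact: (Pe (exist _ d de)).
  by rewrite -edge_repN => de; apply: Pa; exact: (Pe (exist _ (alpha d) de)).
have [|||||x xu] := exact_of_euler (a := a) (b := b) _ _ _ _ (u := fun e => (A (val e))%:R).
(* A corner of [f] at [v] is counted once from each of the two darts beside it, hence vanishes mod
   2. *)
- move=> f v; pose g d : 'F_2 :=
    ((face_rep d == f)%:R + (face_rep ((sigma^-1)%g d) == f)%:R) * (tail d == v)%:R.
  rewrite (eq_bigr (fun e => g (val e) + g (alpha (val e)))) => [|e _]; last first.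
    rewrite /a /b /g mulrDr face_rep_sigmaV_alpha face_alpha; congr (_ + _).
    by rewrite addrC.
  rewrite sum_edges /g; under eq_bigr => d _ do rewrite mulrDl.
  rewrite big_split /= [X in _ + X](reindex_inj (perm_inj (s := sigma))) /=.
  under [X in _ + X]eq_bigr => d _ do rewrite permK tail_sigma.
  exact: F2_addrr.
- move=> x hx.
  have hD d : x (face_rep d) = x (face_rep ((sigma^-1)%g d)).
    elim/on_edges: d => [d|e]; first by rewrite face_rep_sigmaV_alpha face_alpha => ->.
    by apply: F2_add_eq0; rewrite -xa.
  have hc := map_invariant (g := fun d => x (face_rep d)).
  move=> f f'; rewrite -(face_rep_id f) -(face_rep_id f'); apply: hc => d.
    by rewrite face_alpha -hD.
  by rewrite hD permK.
- move=> y hy.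
  have hD d : y (tail d) = y (head d).
    elim/on_edges: d => [d|e]; first by rewrite /Defs.head alphaK.
    by apply: F2_add_eq0; rewrite -yb.
  move=> v v'; case: planeM => _ _ surj _ _.
  have [[d <-] [d' <-]] := (surj v, surj v').
  apply: (map_invariant (g := fun d => y (tail d))) => e; first by rewrite hD /Defs.head alphaK.
  by rewrite tail_sigma.
- case: planeM => _ _ _ _; rewrite card_edges card_sig => <-.
  rewrite leq_add2l; apply/eq_leq/eq_card => d.
  by rewrite !inE andbT.
- move=> v; pose g d : 'F_2 := (A d)%:R * (tail d == v)%:R.
  rewrite (eq_bigr (fun e => g (val e) + g (alpha (val e)))) => [|e _]; last first.
    by rewrite /b /g mulrDr Aa.
  rewrite sum_edges /g; under eq_bigr => d _ do rewrite -natrM mulnb.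
  rewrite -natr_sum.
  have -> : (\sum_d (A d && (tail d == v)))%N = #|[set d | (tail d == v) && A d]|.
    rewrite -sum1_card [RHS]big_mkcond /=; apply: eq_bigr => d _; rewrite inE andbC.
    by case: ifP.
  by apply/val_inj; rewrite /= val_Fp_nat // modn2; move: (Aev v); case: odd.
pose S d := x (face_rep d) == 1.
have hS d : A d = S d (+) S ((sigma^-1)%g d).
  elim/on_edges: d => [d|e].
    by rewrite Aa /S face_rep_sigmaV_alpha face_alpha addbC.
  move: (xu e); rewrite xa /S; move: (x _) (x _) => y z.
  by case: y z (A _) => [[|[|?]] ?] // [[|[|?]] ?] // [].
exists S; split=> // d; rewrite /S; congr (x _ == 1); apply/esym/face_repP.
exact: fconnect1.
Qed.

End Homology.

Lemma fconnect_permV (T : finType) (s : {perm T}) :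
  fconnect (s^-1)%g =2 fconnect s.
Proof.
move=> x y; rewrite -(same_fconnect_finv (@perm_inj _ s)).
by apply: eq_fconnect => z; rewrite (finv_eq_can (permK s)).
Qed.

(** * The color-dependent rotation and regions described by darts *)

Section Turn.
Variables (D V : finType) (alpha : D -> D) (sigma : {perm D}) (tail : D -> V).
Variable col : V -> bool.
Hypothesis planeM : plane_map alpha sigma tail.
Hypothesis colP : proper_coloring alpha tail col.
Local Notation phi := (Defs.phi alpha sigma).

(* Reversing the rotation at white vertices makes the two local conditions of
   a separating decomposition identical for both colors. *)
Definition turn d := if col (tail d) then sigma d else (sigma^-1)%g d.

(* The corner between [d] and [turn d]. *)
Definition front d := if col (tail d) then d else (sigma^-1)%g d.

Lemma tail_turn d : tail (turn d) = tail d.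
Proof. by rewrite /turn; case: ifP; rewrite ?(tail_sigma planeM) ?(tail_sigmaV planeM). Qed.

Lemma turn_inj : injective turn.
Proof.
move=> d e de; have te : tail d = tail e by rewrite -tail_turn de tail_turn.
by move: de; rewrite /turn te; case: ifP => _; apply: perm_inj.
Qed.

(** [turn] keeps the tail and hence the color, so the same permutation is applied at every step. *)
Lemma iter_turn k d :
  iter k turn d = iter k (if col (tail d) then sigma : D -> D else (sigma^-1)%g) d.
Proof.
elim: k => //= k <-; have -> : col (tail d) = col (tail (iter k turn d)).
  by elim: k => //= k ->; rewrite tail_turn.
by rewrite /turn; case: ifP.
Qed.

Lemma fconnect_turn d e : fconnect turn d e = (tail d == tail e).
Proof.
case: planeM => _ -> _ _ _; apply/idP/idP => /iter_findex <-.
  rewrite iter_turn; case: ifP => _; first exact: fconnect_iter.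
  by rewrite -fconnect_permV fconnect_iter.
set k := findex sigma d e; case cd: (col (tail d)).
  by have := fconnect_iter turn k d; rewrite iter_turn cd.
have : fconnect (sigma^-1)%g d (iter k sigma d) by rewrite fconnect_permV fconnect_iter.
move/iter_findex <-; set m := findex _ _ _.
by have := fconnect_iter turn m d; rewrite iter_turn cd.
Qed.

Lemma order_turn d : fingraph.order turn d = fingraph.order sigma d.
Proof.
apply: eq_card => e; rewrite !inE fconnect_turn.
by case: planeM => _ ->.
Qed.

Lemma map_invariant_turn (T : eqType) (g : D -> T) :
  (forall d, g (alpha d) = g d) -> (forall d, g (turn d) = g d) ->
  forall d e, g d = g e.
Proof.
move=> ga gr; apply: (map_invariant planeM) => // d.
case cd: (col (tail d)); first by rewrite -[RHS]gr /turn cd.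
by rewrite -gr /turn (tail_sigma planeM) cd permK.
Qed.

Lemma col_alpha d : col (tail (alpha d)) = ~~ col (tail d).
Proof. by have := colP d; rewrite /Defs.head; do 2!case: col. Qed.

(* [alpha] joins darts whose front corners lie in the same face, so a set of
   faces becomes an [alpha]-invariant set of darts. *)
Lemma plane_region (A : D -> bool) (o : D) :
  (forall d, A (alpha d) = A d) ->
  (forall v, ~~ odd #|[set d | (tail d == v) && A d]|) ->
  exists T : D -> bool, [/\ forall d, T (alpha d) = T d,
    forall d, T (turn d) = T d (+) A (turn d) &
    forall d, col (tail d) -> fconnect phi o d -> ~~ T d].
Proof.
move=> Aa /(plane_cycle_bounds planeM Aa)[S [Sphi SA]].
(* Adding the constant [S o] complements the set of faces if it contains the outer one. *)
exists (fun d => S (front d) (+) S o); split=> [d|d|d cd].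
- congr (_ (+) _); rewrite /front col_alpha.
  case: (col (tail d)) => /=.
    by rewrite -[LHS]Sphi /Defs.phi permKV (alphaK planeM).
  by rewrite -[RHS]Sphi /Defs.phi permKV.
- rewrite SA addbAC; congr (_ (+) _); rewrite /front tail_turn /turn.
  by case: (col (tail d)); rewrite ?permK; do 2!case: (S _).
move=> /(fconnect_invariant (k := S)) -> => [|e]; first by rewrite /front cd addbb.
by rewrite /= Sphi eqxx.
Qed.

End Turn.

(** Pigeonhole: after [order f x] steps the orbit is back at an earlier point, which is periodic. *)
Lemma fconnect_periodic (T : finType) (f : T -> T) x :
  exists2 y, fconnect f x y & fconnect f (f y) y.
Proof.
have /trajectP[i lti itE] := looping_order f x.
exists (iter i f x); first exact: fconnect_iter.
have yE : iter (fingraph.order f x - i.+1) f (f (iter i f x)) = iter i f x.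
  by rewrite -[f (iter i f x)]/(iter i.+1 f x) -iterD subnK.
by rewrite -[X in fconnect _ _ X]yE fconnect_iter.
Qed.

(** * No monochromatic directed cycles, from the local rules alone *)

Section Acyclic.
Variables (D V : finType) (alpha : D -> D) (sigma : {perm D}) (tail : D -> V).
Variable col : V -> bool.
Hypothesis planeM : plane_map alpha sigma tail.
Hypothesis colP : proper_coloring alpha tail col.
Local Notation phi := (Defs.phi alpha sigma).
Local Notation head := (Defs.head alpha tail).
Local Notation rho := (turn sigma tail col).

Variables (c out : D -> bool) (sink : bool -> V) (base : bool -> D) (o : D).
Hypothesis c_alpha : forall d, c (alpha d) = c d.
Hypothesis out_alpha : forall d, out (alpha d) = ~~ out d.
Hypothesis out_turn : forall d, out d = (c d != c (rho d)).
Hypothesis c_sink : forall i d, tail d = sink i -> c d = i.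
Hypothesis out_ex : forall i v, v != sink false -> v != sink true ->
  exists d, [/\ tail d = v, out d & c d = i].
Hypothesis out_uniq : forall d e,
  tail d = tail e -> out d -> out e -> c d = c e -> d = e.
Hypothesis tail_base : forall i, tail (base i) = sink i.
Hypothesis col_sink : forall i, col (sink i).
Hypothesis base_outer : forall i, fconnect phi o (base i).

Lemma sink_not_out i d : tail d = sink i -> ~~ out d.
Proof. by move=> di; rewrite out_turn negbK !(c_sink (i := i)) ?(tail_turn _ planeM). Qed.

Lemma out_exists i d : out d -> exists e, [/\ tail e = tail d, out e & c e = i].
Proof.
by move=> od; apply: out_ex; apply: contraL od => /eqP; apply: sink_not_out.
Qed.

(** The next dart on the monochromatic path. For an outgoing [d], the default is reached only when
    [head d] is the sink of its color. *)
Definition step d :=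
  odflt d [pick e | [&& tail e == head d, out e & c e == c d]].

Lemma stepP d : out d -> head d != sink (c d) ->
  [/\ tail (step d) = head d, out (step d) & c (step d) = c d].
Proof.
move=> od hd; rewrite /step; case: pickP => [e /and3P[/eqP-> -> /eqP->] //|none].
(* An edge ending at the other sink would have the other color. *)
have hd' : head d != sink (~~ c d).
  apply/eqP => /c_sink; rewrite c_alpha; by case: (c d).
have [|| e [te oe ce]] := @out_ex (c d) (head d); try by case: (c d) hd hd'.
by have := none e; rewrite te oe ce !eqxx.
Qed.

(* Turning from [d] keeps the color until the first outgoing dart. *)
Lemma walk_to_out (Q : D -> Prop) d e :
  tail d = tail e -> out e -> Q d ->
  (forall x, tail x = tail d -> ~~ out x -> c x = c d -> rho x != d ->
     c (rho x) = c d -> Q x -> Q (rho x)) ->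
  exists x, [/\ tail x = tail d, out x, c x = c d & Q x].
Proof.
move=> de oe Qd Qstep; have fde : fconnect rho d e by rewrite (fconnect_turn _ planeM) de.
have ti m : tail (iter m rho d) = tail d by elim: m => //= m <-; apply: (tail_turn _ planeM).
suff found m : m <= findex rho d e ->
    (exists x, [/\ tail x = tail d, out x, c x = c d & Q x]) \/
    (c (iter m rho d) = c d /\ Q (iter m rho d)).
  case: (found (findex rho d e)) => //; rewrite iter_findex // => -[ce Qe].
  by exists e; rewrite de.
elim: m => [|m IH] ltm; first by right.
case: (IH (ltnW ltm)) => [|[cm Qm]]; first by left.
case om: (out (iter m rho d)); first by left; exists (iter m rho d).
right; have cm1 : c (rho (iter m rho d)) = c d.
  by have := out_turn (iter m rho d); rewrite om cm => /esym/negbFE/eqP.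
split=> //=; apply: Qstep; rewrite ?ti ?om //.
apply/eqP => /(congr1 (findex rho d)); rewrite -iterS findex_iter ?findex0 //.
by rewrite (leq_ltn_trans ltm) ?findex_max.
Qed.

(* [T] is a set of faces with boundary [A] missing the outer face; a face is
   recorded by the darts having it as front corner. *)
Definition region (A T : D -> bool) := [/\ forall d, T (alpha d) = T d,
  forall d, T (rho d) = T d (+) A (rho d) & forall i, ~~ T (base i)].

(** Turning at [head z] from [alpha z] to [step z] meets only darts of the color of [z], and none of
    these is on the boundary. *)
Lemma region_step (A T : D -> bool) i z : region A T -> (forall d, A d -> c d = i) ->
  out z -> c z != i -> head z != sink (c z) -> T (step z) = T z.
Proof.
move=> [Ta Tr _] Ac oz ci hz; have [ts os cs] := stepP oz hz.
have [||||x [tx ox cx Tx]] := @walk_to_out (fun x => T x = T z) (alpha z) (step z).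
- by rewrite ts.
- by [].
- by rewrite Ta.
- move=> x _ _ _ _ cr <-; rewrite Tr [A _]negbTE ?addbF //.
  by apply: contra ci => /Ac <-; rewrite cr c_alpha.
rewrite -Tx; congr T; apply: out_uniq => //; first by rewrite tx ts.
by rewrite cx c_alpha.
Qed.

(** Around the sink of the color of [z] there is no boundary dart, so [T] is constant there; but
    [base] lies outside [T]. *)
Lemma region_avoids_sink (A T : D -> bool) i z : region A T -> (forall d, A d -> c d = i) ->
  out z -> c z != i -> T z -> head z != sink (c z).
Proof.
move=> [Ta Tr Tb] Ac oz ci Tz; apply/eqP => hz.
have : fconnect rho (alpha z) (base (c z)) by rewrite (fconnect_turn _ planeM) tail_base -hz.
move/iter_findex; set k := findex _ _ _ => kE.
suff : T (iter k rho (alpha z)) by rewrite kE (negbTE (Tb _)).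
elim: k {kE} => [|k IH] /=; first by rewrite Ta.
rewrite Tr IH /=; apply: contra ci => /Ac <-; apply/eqP/esym.
apply: c_sink; rewrite (tail_turn _ planeM) // -hz.
by elim: k {IH} => //= k <-; rewrite (tail_turn _ planeM).
Qed.

(** The second clause keeps [step] from taking its default value along the orbit. *)
Definition cyclic x := [/\ out x,
  forall y, fconnect step x y -> head y != sink (c y) & fconnect step (step x) x].

Lemma cyclic_connect x y : cyclic x -> fconnect step x y -> out y /\ c y = c x.
Proof.
case=> ox hx _ /iter_findex <-; elim: (findex _ _ _) => //= k [ok ck].
by have [] := stepP ok (hx _ (fconnect_iter _ _ _)) => _ -> ->.
Qed.

Definition trace x : pred D := fun d => fconnect step x d || fconnect step x (alpha d).

Lemma traceN x d : trace x (alpha d) = trace x d.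
Proof. by rewrite /trace (alphaK planeM) orbC. Qed.

Lemma trace_color x d : cyclic x -> trace x d -> c d = c x.
Proof. by move=> cx /orP[] /(cyclic_connect cx)[_ <-]. Qed.

(** Darts with a common head have the same successor, and [step] is injective on its cycle. *)
Lemma cyclic_step_inj x y z : cyclic x -> fconnect step x y -> fconnect step x z ->
  head y = head z -> y = z.
Proof.
move=> cx xy xz yz; have [oy cy] := cyclic_connect cx xy.
have [oz cz] := cyclic_connect cx xz; have [_ hx per] := cx.
have [[ty oy' cy'] [tz oz' cz']] := (stepP oy (hx _ xy), stepP oz (hx _ xz)).
have inj : {in orbit step x &, injective step}.
  by apply/injectivePcycle; rewrite -fconnect_f.
by apply: inj; rewrite -?fconnect_orbit //; apply: out_uniq; rewrite ?ty ?tz ?cy' ?cz' ?cy ?cz.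
Qed.

(** [step] pairs each arrival of the cycle at [v] ([A2], reversed) with the departure after it
    ([A1]). *)
Lemma trace_even x v : cyclic x -> ~~ odd #|[set d | (tail d == v) && trace x d]|.
Proof.
move=> cx; have [_ hx per] := cx.
have inj : {in orbit step x &, injective step}.
  by apply/injectivePcycle; rewrite -fconnect_f.
pose A1 := [set d | (tail d == v) && fconnect step x d].
pose A2 := [set d | (tail d == v) && fconnect step x (alpha d)].
have -> : [set d | (tail d == v) && trace x d] = A1 :|: A2.
  by apply/setP => d; rewrite !inE -andb_orr.
have dis : A1 :&: A2 = set0.
  apply/setP => d; rewrite !inE; apply/negP => /andP[/andP[_ xd] /andP[_ xad]].
  have [od _] := cyclic_connect cx xd; have [] := cyclic_connect cx xad.
  by rewrite out_alpha od.
rewrite cardsU dis cards0 subn0.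
suff -> : A1 = [set step (alpha d) | d in A2].
  rewrite card_in_imset ?addnn ?odd_double // => d e.
  rewrite !inE => /andP[_ xd] /andP[_ xe] /inj; rewrite -!fconnect_orbit => /(_ xd xe).
  exact: (can_inj (alphaK planeM)).
have tstep y : fconnect step x y -> tail (step y) = head y.
  by move=> xy; have [oy _] := cyclic_connect cx xy; have [] := stepP oy (hx _ xy).
apply/setP => d; apply/idP/imsetP => [|[e]]; last first.
  rewrite !inE => /andP[/eqP te xe] ->; rewrite tstep // /Defs.head (alphaK planeM) te eqxx.
  exact: connect_trans xe (fconnect1 _ _).
rewrite !inE => /andP[/eqP td xd].
have xp : fconnect step x (finv step d) by apply: connect_trans xd (fconnect_finv _ _).
have pd : step (finv step d) = d.
  by apply: (f_finv_in (@mem_orbit _ step x) inj); rewrite -fconnect_orbit.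
exists (alpha (finv step d)); last by rewrite (alphaK planeM) pd.
by rewrite inE (alphaK planeM) xp andbT -td -{2}pd tstep.
Qed.

Lemma cyclic_region x : cyclic x -> exists T, region (trace x) T.
Proof.
move=> cx; have [||T [Ta Tr Tb]] := plane_region planeM colP (A := trace x) o.
- exact: traceN.
- by move=> v; apply: trace_even.
by exists T; split=> // i; apply: Tb => //; rewrite tail_base.
Qed.

(* The region lies alternately on either side along a monochromatic cycle. *)
Lemma region_flips x T : cyclic x -> region (trace x) T -> T (step x) = ~~ T x.
Proof.
move=> cx [Ta Tr _]; have [ox hx per] := cx.
have [ts os cs] := stepP ox (hx _ (connect0 _ _)).
(* Turning from [alpha x], the first dart of the cycle met is [step x]: another arrival would be
   [alpha x] itself, after a full turn. *)
have [||||y [ty oy cy]] := @walk_to_out (fun y => T y = T x (+) out y) (alpha x) (step x).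
- by rewrite ts.
- by [].
- by rewrite Ta out_alpha ox addbF.
- move=> y ty oy cy nr cr; rewrite Tr (negbTE oy) addbF => ->; congr (_ (+) _).
  have tr : tail (rho y) = head x by rewrite (tail_turn _ planeM).
  case oR: (out (rho y)).
    apply/orP; left; rewrite (_ : rho y = step x) ?fconnect1 //.
    by apply: out_uniq; rewrite ?tr ?ts // cr c_alpha cs.
  apply/negP => /orP[/(cyclic_connect cx)[]|xr]; first by rewrite oR.
  case/eqP: nr; rewrite -[LHS](alphaK planeM); congr alpha.
  by apply: (cyclic_step_inj cx xr) => //; rewrite /Defs.head (alphaK planeM).
suff -> : y = step x by rewrite os addbT.
by apply: out_uniq; rewrite ?ty ?ts // cy c_alpha cs.
Qed.

Lemma smaller_region x T : cyclic x -> region (trace x) T ->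
  exists x' T', [/\ cyclic x', region (trace x') T' & #|[set d | T' d]| < #|[set d | T d]|].
Proof.
move=> cx regT; have [ox hx per] := cx; have [Ta Tr Tb] := regT.
have Tflip := region_flips cx regT.
have [y xy Ty] : exists2 y, fconnect step x y & T y.
  by case Tx: (T x); [exists x | exists (step x); rewrite ?fconnect1 // Tflip Tx].
have [oy cy] := cyclic_connect cx xy.
have rc d : trace x d -> c d = c x by apply: trace_color.
(* Just after the outgoing [y] the color changes; turning on to the next outgoing dart crosses no
   boundary and stays in [T]. *)
have [u [tu ou cu Tu]] : exists u, [/\ tail u = tail y, out u, c u = ~~ c x & T u].
  have [e [te oe _]] := out_exists true oy.
  have cry : c (rho y) = ~~ c x by have := out_turn y; rewrite oy cy; do 2!case: (c _).
  have Tn d : c d = ~~ c x -> trace x d = false.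
    by move=> cd; apply/negP => /rc; rewrite cd; case: (c x).
  have [||||z [tz oz cz Tz]] := @walk_to_out (fun y => T y) (rho y) e.
  - by rewrite (tail_turn _ planeM).
  - by [].
  - by rewrite Tr Ty Tn.
  - by move=> z _ _ _ _ cz Tz; rewrite Tr Tz Tn // cz.
  by exists z; rewrite tz (tail_turn _ planeM) // cz.
(* Invariant of the path from [u]: it is trapped in [T], away from its sink, and so becomes
   periodic. *)
pose Q d := [/\ out d, c d = ~~ c x & T d].
have cN d : c d = ~~ c x -> c d != c x by move=> ->; case: (c x).
have Qsink d : Q d -> head d != sink (c d).
  by case=> od cd Td; apply: (region_avoids_sink regT rc) => //; apply: cN.
have Qstep d : Q d -> Q (step d).
  move=> Qd; have hd := Qsink d Qd; have [od cd Td] := Qd.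
  have [ts os cs] := stepP od hd.
  by split=> //; rewrite ?cs // (region_step regT rc) ?cN.
have Qconnect d e : Q d -> fconnect step d e -> Q e.
  by move=> Qd /iter_findex <-; elim: (findex _ _ _) => //= k; apply: Qstep.
have Qu : Q u by [].
have [x' ux' per'] := fconnect_periodic step u.
have Qx' := Qconnect _ _ Qu ux'.
have cx' : cyclic x'.
  by split=> // [|z xz]; [case: Qx' | apply/Qsink/(Qconnect _ _ Qx')].
have [T' regT'] := cyclic_region cx'; have [Ta' Tr' Tb'] := regT'.
exists x', T'; split=> //.
have cxx' : c x' = ~~ c x by case: Qx'.
have rc' d : trace x' d -> c d = ~~ c x by rewrite -cxx'; apply: trace_color.
have Tin d : trace x' d -> T d.
  by case/orP => /(Qconnect _ _ Qx')[_ _]; rewrite ?Ta.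
have disj d : trace x d -> trace x' d -> False.
  by move=> /rc cd /rc'; rewrite cd; case: (c x).
have Tcst z : fconnect step x z -> T' z = T' x.
  move=> /[dup] + /iter_findex; move=> _ <-; elim: (findex _ _ _) => //= k <-.
  have xk := fconnect_iter step k x; have [ok ck] := cyclic_connect cx xk.
  by apply: (region_step regT' rc'); rewrite ?ck ?hx // -?ck ?hx //; case: (c _).
have Ttrace d : trace x d -> T' d = T' x.
  by case/orP => /Tcst; rewrite ?Ta'.
(* [T'] is constant along the cycle of [x], since walking along it only crosses
   darts of its own color; so [T' :\: T] changes nowhere or exactly where [T]
   does, and [g] is constant. *)
pose g d := (T' d && ~~ T d) (+) (T' x && T d).
have g0 d : g d = false.
  have -> : g d = g (base true); last by rewrite /g (negbTE (Tb _)) (negbTE (Tb' _)) andbF.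
  apply: (map_invariant_turn planeM (col := col)) => e; first by rewrite /g Ta Ta'.
  have := (Tr e, Tr' e, Ttrace (rho e), disj (rho e), Tin (rho e)).
  rewrite /g; case: (trace x (rho e)) (trace x' (rho e)) => -[] [[[[-> ->] ht] hd] hi].
  - by case: hd.
  - by move: ht; rewrite addbF => -> //; do 2!case: (T' _) => //=; case: (T _).
  - by move: hi; rewrite addbF addbT => -> //; rewrite !andbF.
  - by rewrite !addbF.
(* Otherwise [g] is the union of [T] and [T']; its emptiness contradicts that [T] flips along the
   cycle of [x]. *)
have Tx' : T' x = false.
  apply/negP => Tx; have allT d : T d = false.
    by move: (g0 d); rewrite /g Tx; case: (T' d) (T d) => -[].
  by move: Tflip; rewrite !allT.
apply: proper_card; rewrite properEneq; apply/andP; split; last first.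
  apply/subsetP => d; rewrite !inE => Td; move: (g0 d).
  by rewrite /g Tx' Td /= addbF => /negbFE.
(* The inclusion is strict: crossing [x'] changes [T'] but not [T]. *)
apply/eqP => /setP eqT; have eqTT d : T' d = T d by have := eqT d; rewrite !inE.
have xr : rho (finv rho x') = x' by apply/f_finv/(turn_inj planeM).
have := Tr (finv rho x'); have := Tr' (finv rho x'); rewrite xr !eqTT => ->.
have t' : trace x' x' by rewrite /trace connect0.
rewrite t'; case t: (trace x x'); first by case: (disj _ t t').
by case: (T _).
Qed.

Lemma no_cyclic x : ~ cyclic x.
Proof.
move=> cx; have [T regT] := cyclic_region cx.
have [n] := ubnP #|[set d | T d]|; elim: n x T cx regT => // n IH x T cx regT ltn.
have [x' [T' [cx' regT' lt]]] := smaller_region cx regT.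
by apply: (IH x' T' cx' regT'); apply: leq_trans lt _.
Qed.

(** If the sink were unreachable, the path of color [i] from [v] would never end and would run into
    a cycle. *)
Lemma connect_sink i (inT : D -> bool) v : inT =1 (fun d => c d == i) ->
  v != sink (~~ i) -> connect (tree_arc alpha tail inT out) v (sink i).
Proof.
move=> inTE vN; have [->|vi] := eqVneq v (sink i); first exact: connect0.
have [|| x [tx ox cxi]] := @out_ex i v; try by case: (i) vN vi.
apply/negPn/negP => nc.
have arc d : out d -> c d = i -> connect (tree_arc alpha tail inT out) (tail d) (head d).
  by move=> od cd; apply/connect1/existsP; exists d; rewrite inTE cd od !eqxx.
have inv d : fconnect step x d -> [/\ out d, c d = i &
    connect (tree_arc alpha tail inT out) v (tail d)].
  move=> /iter_findex <-; elim: (findex _ _ _) => [|k [ok ck vk]] /=.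
    by rewrite tx; split=> //; apply: connect0.
  have vh := connect_trans vk (arc _ ok ck).
  have hk : head (iter k step x) != sink (c (iter k step x)).
    by rewrite ck; apply: contraNneq nc => <-.
  by have [-> -> ->] := stepP ok hk.
have [y xy py] := fconnect_periodic step x.
apply: (@no_cyclic y); split=> //; first by case: (inv y xy).
move=> z yz; have [oz cz vz] := inv z (connect_trans xy yz).
by rewrite cz; apply: contraNneq nc => <-; apply: connect_trans vz (arc _ oz cz).
Qed.

End Acyclic.

(** * Cyclic binary words around a vertex, studied through their rises *)

Section Rises.
Variables (D V : finType) (tail : D -> V) (f : D -> D).
Hypothesis tailE : forall d e, fconnect f d e = (tail d == tail e).
Hypothesis f_inj : injective f.

Definition rises (g : D -> bool) v := [set d | [&& tail d == v, ~~ g d & g (f d)]].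

Lemma tail_orbit_map d : tail (f d) = tail d.
Proof. by apply/esym/eqP; rewrite -tailE fconnect1. Qed.

Lemma tail_orbit_iter k d : tail (iter k f d) = tail d.
Proof. by elim: k => //= k <-; apply: tail_orbit_map. Qed.

(** A cyclic word has as many falls as rises: [A] and its preimage have equal size, hence so do
    their two differences. *)
Lemma card_risesN g v : #|rises (fun d => ~~ g d) v| = #|rises g v|.
Proof.
pose A := [set d | (tail d == v) && g d].
have cA : #|f @^-1: A| = #|A| by apply: card_preimset.
have up : rises g v = f @^-1: A :\: A.
  by apply/setP => d; rewrite !inE tail_orbit_map; case: eqP; case: (g d); case: (g (f d)).
have down : rises (fun d => ~~ g d) v = A :\: f @^-1: A.
  by apply/setP => d; rewrite !inE tail_orbit_map negbK; case: eqP; case: (g d); case: (g (f d)).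
apply/eqP; rewrite up down -(eqn_add2l #|A :&: f @^-1: A|) cardsID.
by rewrite setIC cardsID cA.
Qed.

Lemma card_rises_comp g v : #|rises (g \o f) v| = #|rises g v|.
Proof.
have -> : rises (g \o f) v = f @^-1: rises g v.
  by apply/setP => d; rewrite !inE tail_orbit_map.
exact: card_preimset.
Qed.

(** The arc starts just after the unique rise [e] and ends at the first false value; becoming true
    again before [e] would be a second rise. *)
Lemma one_arcP g v :
  (exists d k, [/\ tail d = v, 0 < k < fingraph.order f d &
     forall i, i < fingraph.order f d -> g (iter i f d) = (i < k)]) <->
  #|rises g v| = 1.
Proof.
split=> [[d [k [dv /andP[k0 kn] gk]]]|/eqP/cards1P[e eE]].
  apply/eqP/cards1P; exists (iter (fingraph.order f d).-1 f d); apply/setP => x.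
  have last_succ : f (iter (fingraph.order f d).-1 f d) = d.
    by rewrite -iterS orderSpred iter_order.
  rewrite !inE; apply/and3P/eqP => [[/eqP xv ngx gfx]|->]; last first.
    have n0 := fingraph.order_gt0 f d; split; first by rewrite tail_orbit_iter dv.
      by rewrite gk; lia.
    by rewrite last_succ (gk 0).
  have dx : fconnect f d x by rewrite tailE dv xv.
  have := findex_max dx; have := iter_findex dx; move: (findex f d x) => i xE ltin.
  move: ngx gfx; rewrite -xE gk // -iterS -leqNgt => ki gS.
  congr (iter _ f d); move: gS; case: (ltnP i.+1 (fingraph.order f d)) => [lt|]; last by lia.
  by rewrite gk //; lia.
have : e \in rises g v by rewrite eE set11.
rewrite inE => /and3P[/eqP ev nge gfe].
have eN : iter (fingraph.order f (f e)).-1 f (f e) = e.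
  by apply: f_inj; rewrite -iterS orderSpred iter_order.
have ex : exists i, ~~ g (iter i f (f e)) by exists (fingraph.order f (f e)).-1; rewrite eN.
case: (ex_minnP ex) => k ngk kmin.
have kle : k <= (fingraph.order f (f e)).-1 by apply: kmin; rewrite eN.
have n0 := fingraph.order_gt0 f (f e).
have k0 : 0 < k by case: (k) ngk => //=; rewrite gfe.
exists (f e), k; split; [by rewrite tail_orbit_map | lia | move=> i lti].
case: ltnP => [ik|]; first by apply: contraTT ik => /kmin; rewrite -leqNgt.
elim: i lti => [|i IH] lti; first by move=> k_le0; lia.
rewrite leq_eqVlt => /orP[/eqP <-|ki]; first exact: negbTE.
have {IH} gi := IH (ltnW lti) ki; apply/negP => gS.
have : iter i f (f e) \in rises g v.
  by rewrite inE tail_orbit_iter tail_orbit_map ev eqxx gi gS.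
rewrite eE inE => /eqP iE; have := congr1 (findex f (f e)) (etrans iE (esym eN)).
by rewrite !findex_iter; lia.
Qed.

(** Splits the type at position [i] into its color [a < i] and its orientation, outgoing at [a] and
    at the last position. *)
Lemma nth_pattern a b i : i < a + b + 2 ->
  nth 0 (nseq a 0 ++ 1 :: nseq b 2 ++ [:: 3]) i =
  2 * (a < i) + ((i == a) || (i == a + b + 1)).
Proof.
move=> lti; rewrite nth_cat size_nseq nth_nseq; case: ltnP => ia; first by lia.
case E: (i - a) => [|j] /=; first by lia.
rewrite nth_cat size_nseq nth_nseq; case: ltnP => jb; first by lia.
have -> : j - b = 0 by lia.
rewrite /=; lia.
Qed.

Variables c out : D -> bool.

(** Each color block ends with its outgoing dart, so [out] marks the cyclic changes of [c], and the
    word has just two blocks. *)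
Lemma typesP v :
  (exists d a b, tail d = v /\
     [seq dart_type c out (iter k f d) | k <- iota 0 (fingraph.order f d)]
       = nseq a 0 ++ 1 :: nseq b 2 ++ [:: 3]) <->
  (forall d, tail d = v -> out d = (c d != c (f d))) /\ #|rises c v| = 1.
Proof.
split=> [[d [a [b [dv types]]]]|[outE]].
  set n := fingraph.order f d in types.
  have nE : n = a + b + 2.
    have := congr1 size types; rewrite size_map size_iota size_cat size_nseq /=.
    by rewrite size_cat size_nseq /=; lia.
  have ti i : i < n -> c (iter i f d) = (a < i) /\
      out (iter i f d) = (i == a) || (i == a + b + 1).
    move=> lti; have := congr1 (fun s => nth 0 s i) types.
    rewrite (nth_map 0) ?size_iota // nth_iota // nth_pattern -?nE // /dart_type add0n.
    by case: (c _) (out _) => -[]; case: (a < i) (_ || _) => -[].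
  split.
    move=> e ev; have de : fconnect f d e by rewrite tailE dv ev.
    have := findex_max de; have := iter_findex de; move: (findex f d e) => i <- lti.
    have [-> ->] := ti i lti; rewrite -iterS.
    have [lt|le] := ltnP i.+1 n; first by have [-> _] := ti _ lt; lia.
    have -> : i.+1 = n by rewrite -/n in lti; lia.
    rewrite iter_order //; have [|/= -> _] := ti 0; first by lia.
    rewrite -/n in lti; lia.
  rewrite -card_risesN; apply/one_arcP; exists d, a.+1; split=> //; rewrite -/n; first by lia.
  by move=> i /ti[-> _]; rewrite -leqNgt.
rewrite -card_risesN => /one_arcP[d [k [dv]]]; set n := fingraph.order f d => /andP[k0 kn] ck.
(* The blocks have lengths [k] and [n - k]; one dart in each is outgoing. *)
exists d, k.-1, (n - k.+1); split=> //; rewrite -/n.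
have cE i : i < n -> c (iter i f d) = (k <= i).
  by move/ck => /(congr1 negb); rewrite negbK -leqNgt.
apply: (@eq_from_nth _ 0).
  rewrite size_map size_iota size_cat size_nseq /= size_cat size_nseq /=; lia.
rewrite size_map size_iota => i lti.
rewrite (nth_map 0) ?size_iota // nth_iota // nth_pattern; last by lia.
rewrite add0n /dart_type outE ?tail_orbit_iter // cE // -iterS.
have [lt|le] := ltnP i.+1 n; first by rewrite cE //; lia.
have -> : i.+1 = n by lia.
by rewrite iter_order // (cE 0); lia.
Qed.

End Rises.

(** * Labelings and decompositions of a quadrangulation, and their translation *)

Section Quadrangulation.
Variables (D V : finType) (alpha : D -> D) (sigma : {perm D}) (tail : D -> V).
Variables (col : V -> bool) (o : D) (s0 s1 : V).
Hypothesis quadM : quadrangulation alpha sigma tail.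
Hypothesis colP : proper_coloring alpha tail col.
Hypotheses (col0 : col s0) (col1 : col s1) (s01 : s0 != s1).
Hypothesis face0 : on_face alpha sigma tail o s0.
Hypothesis face1 : on_face alpha sigma tail o s1.
Local Notation phi := (Defs.phi alpha sigma).
Local Notation rho := (turn sigma tail col).

Lemma quad_plane : plane_map alpha sigma tail. Proof. by case: quadM. Qed.
Let planeM := quad_plane.

Lemma col_phi d : col (tail (phi d)) = ~~ col (tail d).
Proof. by rewrite /Defs.phi (col_alpha colP) (tail_sigma planeM). Qed.

Lemma phi4 d : phi (phi (phi (phi d))) = d.
Proof.
have := iter_order (phi_inj planeM) d.
by case: quadM => _ _ _ /(_ d)[-> _].
Qed.

Lemma face_ind (P : D -> Prop) d e : fconnect phi d e ->
  P d -> P (phi d) -> P (phi (phi d)) -> P (phi (phi (phi d))) -> P e.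
Proof.
move=> de; have := findex_max de; have := iter_findex de.
by move: (findex _ _ _) => i <-; case: quadM => _ _ _ /(_ d)[-> _]; case: i => [|[|[|[|]]]].
Qed.

Lemma alternating_labels L : strong_labeling alpha sigma tail o s0 s1 L ->
  forall d, L (phi d) = (L d == col (tail d)).
Proof.
case=> _ _ edgeL innerL [eo [oeo teo Leo]].
(* A shift by two negates the cyclic word 0,0,1,1. *)
have opp d : L (phi (phi d)) = ~~ L d.
  have [e [de]] : exists e, fconnect phi d e /\
      face_labels alpha sigma L e = [:: false; false; true; true].
    have [od|/innerL //] := boolP (fconnect phi o d); exists eo; split=> //.
    by rewrite (connect_trans _ oeo) // (fconnect_sym (phi_inj planeM)).
  case=> L0 L1 L2 L3; have ed : fconnect phi e d.
    by rewrite (fconnect_sym (phi_inj planeM)).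
  by apply: (face_ind (P := fun d => L (phi (phi d)) = ~~ L d) ed); rewrite ?phi4 ?L0 ?L1 ?L2 ?L3.
(* [t] records in which of the two ways the labels 0,0,1,1 sit on a face with
   respect to the vertex coloring; rule G2 says it agrees on adjacent faces. *)
pose t d := (L (phi d) == L d) (+) col (tail d).
have t_phi d : t (phi d) = t d.
  by rewrite /t opp col_phi; case: (L d) (L (phi d)) (col _) => -[] [].
have t_sigmaV d : t ((sigma^-1)%g d) = t d.
  rewrite -[RHS]t_phi.
  have phiV : phi ((sigma^-1)%g d) = alpha d by rewrite /Defs.phi permKV.
  have phiA : phi ((sigma^-1)%g (alpha d)) = d by rewrite /Defs.phi permKV (alphaK planeM).
  rewrite t_phi -{2}phiA t_phi /t phiV phiA !(tail_sigmaV planeM) (col_alpha colP).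
  by have := edgeL d; do 4!case: (L _); case: (col _).
have t0 d : t d = false.
  have -> : t d = t eo.
    apply: (map_invariant planeM) => e; last by rewrite -[LHS]t_sigmaV permK.
    by rewrite -[RHS]t_sigmaV -[RHS]t_phi /Defs.phi permKV.
  (* The outer face begins 0,0 at the black vertex [s0], which selects the alternative. *)
  by move: Leo; rewrite /t teo col0 => -[-> -> _ _].
by move=> d; have := t0 d; rewrite /t; case: (L _) (L _) (col _) => -[] [].
Qed.

(** For the converse, opposite corners get opposite labels, so every face has a black corner labeled
    0; read from there it is 0,0,1,1. *)
Lemma strong_labelingE L : strong_labeling alpha sigma tail o s0 s1 L <->
  [/\ forall d, tail d = s0 -> L d = false,
      forall d, tail d = s1 -> L d = true,
      forall v, v != s0 -> v != s1 -> #|rises tail sigma L v| = 1 &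
      forall d, L (phi d) = (L d == col (tail d))].
Proof.
have tailE d e : fconnect sigma d e = (tail d == tail e) by case: planeM => _ ->.
have arcP v := one_arcP tailE (@perm_inj _ sigma) L v.
split=> [/[dup] /alternating_labels alt [[L0 L1] arcL _ _ _]|[L0 L1 arcL alt]].
  by split=> // v v0 v1; apply/arcP/arcL.
have opp d : L (phi (phi d)) = ~~ L d.
  by rewrite !alt col_phi; case: (L d) (col _) => -[].
have black d : col (tail d) -> L d = false ->
    face_labels alpha sigma L d = [:: false; false; true; true].
  by move=> cd Ld; rewrite /face_labels /= !opp alt cd Ld.
split=> //.
- by move=> v v0 v1; apply/arcP/arcL.
- move=> d.
  have phiV : phi ((sigma^-1)%g d) = alpha d by rewrite /Defs.phi permKV.
  have phiA : phi ((sigma^-1)%g (alpha d)) = d by rewrite /Defs.phi permKV (alphaK planeM).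
  have := alt ((sigma^-1)%g d); have := alt ((sigma^-1)%g (alpha d)).
  rewrite phiV phiA !(tail_sigmaV planeM) (col_alpha colP) => -> ->.
  by do 2!case: (L _); case: (col _).
- move=> d _; have [e de ce] : exists2 e, fconnect phi d e & col (tail e).
    case cd: (col (tail d)); first by exists d.
    by exists (phi d); rewrite ?fconnect1 ?col_phi ?cd.
  case Le: (L e); last by exists e; split; last exact: black.
  exists (phi (phi e)); split; first exact: connect_trans de (fconnect_iter _ 2 _).
  by apply: black; rewrite ?opp ?Le // !col_phi negbK.
- case: face0 => e [oe te]; exists e; split=> //.
  by apply: black; rewrite ?te // L0.
Qed.

(** Euler's formula with four darts per face; subtraction-free form of the edge count. *)
Lemma quad_edges : #|D| + 8 = 4 * #|V|.
Proof.
have cF : fcard phi D * 4 = #|D|.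
  apply: (fcard_order_set (phi_inj planeM)) => //.
  by apply/subsetP => d _; rewrite inE; case: quadM => _ _ _ /(_ d)[-> _].
by case: planeM => _ _ _ _ euler; clear -cF euler; lia.
Qed.

Section Decomposition.
Variables c out : D -> bool.

Let tailR d e : fconnect rho d e = (tail d == tail e).
Proof. exact: fconnect_turn planeM d e. Qed.
Let rhoI : injective rho := turn_inj planeM.

Lemma rot_turnE v :
  (let rot := if col v then (sigma : D -> D) else (sigma^-1)%g in
   exists d a b, tail d = v /\
     [seq dart_type c out (iter k rot d) | k <- iota 0 (fingraph.order sigma d)]
       = nseq a 0 ++ 1 :: nseq b 2 ++ [:: 3]) <->
  (exists d a b, tail d = v /\
     [seq dart_type c out (iter k rho d) | k <- iota 0 (fingraph.order rho d)]
       = nseq a 0 ++ 1 :: nseq b 2 ++ [:: 3]).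
Proof.
split=> -[d [a [b [dv types]]]]; exists d, a, b; split=> //; rewrite -types.
  rewrite (order_turn _ planeM); apply: eq_map => k.
  by rewrite (iter_turn _ planeM) dv.
rewrite (order_turn _ planeM); apply: eq_map => k.
by rewrite (iter_turn _ planeM) dv.
Qed.

(** Of the two tree conditions only the colors at [s0] and [s1] are kept. *)
Definition local_decomposition :=
  [/\ forall d, c (alpha d) = c d /\ out (alpha d) = ~~ out d,
      forall d, out d = (c d != c (rho d)),
      forall d, tail d = s0 -> c d = false,
      forall d, tail d = s1 -> c d = true &
      forall v, v != s0 -> v != s1 -> #|rises tail rho c v| = 1].

Lemma outs_rises v : (forall d, tail d = v -> out d = (c d != c (rho d))) ->
  #|rises tail rho c v| = 1 -> #|[set d | out d && (tail d == v)]| = 2.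
Proof.
move=> outE r1; have r2 := card_risesN tailR rhoI c v; rewrite r1 in r2.
have -> : [set d | out d && (tail d == v)] =
    rises tail rho c v :|: rises tail rho (fun d => ~~ c d) v.
  apply/setP => d; rewrite !inE; case: eqP => [/outE ->|]; rewrite ?andbF //.
  by case: (c d) (c (rho d)) => -[].
rewrite cardsU r1 r2 (_ : _ :&: _ = set0) ?cards0 //.
by apply/setP => d; rewrite !inE; case: (c d); rewrite ?andbF.
Qed.

(* Counting: there are 2|V| - 4 edges and two leave each ordinary vertex. *)
Lemma sinks_no_out : (forall d, out (alpha d) = ~~ out d) ->
  (forall v, v != s0 -> v != s1 -> #|[set d | out d && (tail d == v)]| = 2) ->
  forall d, tail d = s0 \/ tail d = s1 -> ~~ out d.
Proof.
move=> oa deg; pose deg_ v := #|[set d | out d && (tail d == v)]|.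
have half : #|[set d | out d]|.*2 = #|D|.
  rewrite -addnn -(cardsC [set d | out d]); congr addn.
  rewrite -(card_imset _ (can_inj (alphaK planeM))); apply: eq_card => d; rewrite !inE.
  by rewrite -{1}[d](alphaK planeM) mem_imset ?inE ?oa //; apply: can_inj (alphaK planeM).
have total : #|[set d | out d]| = \sum_v deg_ v.
  rewrite -sum1_card (partition_big tail xpredT) //=; apply: eq_bigr => v _.
  by rewrite sum1dep_card /deg_; apply: eq_card => d; rewrite !inE.
have Vsplit : #|V| = 2 + \sum_(v | (v != s0) && (v != s1)) 1.
  by rewrite -sum1_card (bigD1 s0) //= (bigD1 s1) //= 1?eq_sym.
move: total; rewrite (bigD1 s0) //= (bigD1 s1) 1?eq_sym //=.
rewrite (eq_bigr (fun=> 2 * 1)) => [|v /andP[v0 v1]]; last by rewrite /deg_ deg.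
rewrite -big_distrr /=; have := quad_edges; rewrite Vsplit -half -muln2.
move: (\sum_(_ | _) 1) => N hE hd.
(* With [N] ordinary vertices, [#|D|] is [4 * N], and the out-degrees of these vertices already sum
   to half of that. *)
have [d0 d1] : deg_ s0 = 0 /\ deg_ s1 = 0 by clear -hE hd; split; lia.
have no v d : deg_ v = 0 -> tail d = v -> ~~ out d.
  move=> /eqP; rewrite cards_eq0 => /eqP/setP/(_ d); rewrite !inE => ov dv.
  by move: ov; rewrite dv eqxx andbT => ->.
by move=> d []; apply: no.
Qed.

Lemma decomposition_local :
  separating_decomposition alpha sigma tail col s0 s1 c out -> local_decomposition.
Proof.
case=> ca tree0 tree1 loc.
have {}loc v : v != s0 -> v != s1 ->
    (forall d, tail d = v -> out d = (c d != c (rho d))) /\ #|rises tail rho c v| = 1.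
  by move=> v0 v1; apply/(typesP tailR rhoI)/rot_turnE/loc.
have no_out : forall d, tail d = s0 \/ tail d = s1 -> ~~ out d.
  apply: sinks_no_out => [d|v v0 v1]; first by case: (ca d).
  by have [outE r1] := loc v v0 v1; apply: outs_rises.
(* An edge of the other tree at [s0] would force an outgoing edge there. *)
have c0 d : tail d = s0 -> c d = false.
  move=> d0; apply/negP => cd; case: tree1 => _ _ /(_ s0 s01 (ex_intro _ d (conj cd d0))) + _.
  move/eqP/cards1P => [e /setP/(_ e)]; rewrite !inE eqxx => /and3P[_ oe /eqP te].
  by have := no_out e (or_introl te); rewrite oe.
have c1 d : tail d = s1 -> c d = true.
  move=> d1; apply/negPn/negP => cd; case: tree0 => _ _ /(_ s1) + _.
  rewrite eq_sym => /(_ s01 (ex_intro _ d (conj cd d1))).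
  move/eqP/cards1P => [e /setP/(_ e)]; rewrite !inE eqxx => /and3P[_ oe /eqP te].
  by have := no_out e (or_intror te); rewrite oe.
split=> // [d|v v0 v1]; last by have [] := loc v v0 v1.
have [d0|d0] := eqVneq (tail d) s0.
  by rewrite (negbTE (no_out d _)) ?c0 ?(tail_turn _ planeM) //; left.
have [d1|d1] := eqVneq (tail d) s1.
  by rewrite (negbTE (no_out d _)) ?c1 ?(tail_turn _ planeM) //; right.
by have [outE _] := loc _ d0 d1; apply: outE.
Qed.

Lemma local_decompositionP :
  local_decomposition -> separating_decomposition alpha sigma tail col s0 s1 c out.
Proof.
case=> ca outE c0 c1 r1.
pose sink (i : bool) := if i then s1 else s0.
have [[e0 [oe0 te0]] [e1 [oe1 te1]]] := (face0, face1).
pose base (i : bool) := if i then e1 else e0.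
have c_sink i d : tail d = sink i -> c d = i by case: i; [apply: c1 | apply: c0].
have no_out i d : tail d = sink i -> ~~ out d.
  by move=> di; rewrite outE negbK (c_sink i d) // (c_sink i (rho d)) // (tail_turn _ planeM).
(* The outgoing dart of color 0 is the unique rise of [c], that of color 1 the unique fall. *)
have outs i v : v != s0 -> v != s1 ->
    #|[set d | [&& c d == i, out d & tail d == v]]| = 1.
  move=> v0 v1; rewrite -(r1 v v0 v1); case: i.
    rewrite -(card_risesN tailR rhoI); apply: eq_card => d; rewrite !inE outE.
    by case: (tail d =P v) => _; case: (c d) (c (rho d)) => -[].
  apply: eq_card => d; rewrite !inE outE.
  by case: (tail d =P v) => _; case: (c d) (c (rho d)) => -[].
have nsink d : out d -> tail d != s0 /\ tail d != s1.
  by move=> od; split; apply: contraL od => /eqP; [apply: (no_out false) | apply: (no_out true)].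
have conn i (inT : D -> bool) v : inT =1 (fun d => c d == i) ->
    v != sink (~~ i) -> connect (tree_arc alpha tail inT out) v (sink i).
  apply: (connect_sink planeM colP (base := base) (o := o)) => //.
  - by move=> d; case: (ca d).
  - by move=> d; case: (ca d).
  - move=> {}i {}v v0 v1; have /eqP/cards1P[d /setP/(_ d)] := outs i v v0 v1.
    by rewrite !inE eqxx => /and3P[/eqP cd od /eqP dv]; exists d.
  - move=> d e de od oe ce; have [d0 d1] := nsink d od.
    have /eqP/cards1P[x /setP xE] := outs (c d) (tail d) d0 d1.
    have := xE d; have := xE e; rewrite !inE de ce od oe !eqxx /=.
    by move=> /esym/eqP-> /esym/eqP->.
  - by case.
  - by case.
  - by case.
split=> //; last 1 first.
- move=> v v0 v1; apply/rot_turnE/(typesP tailR rhoI).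
  by split; [move=> d _; apply: outE | apply: r1].
- split.
  + by exists e0; rewrite te0 c0.
  + by move=> d _; apply: (no_out false).
  + move=> v v0 [d [cd dv]].
    have v1 : v != s1 by apply: contraNneq cd => v1; apply: c1; rewrite dv.
    by rewrite -(outs false v v0 v1); apply: eq_card => e; rewrite !inE; case: (c e).
  + move=> v [d [cd dv]]; apply: (conn false) => [e|]; first by case: (c e).
    by apply: contraNneq cd => v1; apply: c1; rewrite dv.
- split.
  + by exists e1; rewrite te1 c1.
  + by move=> d _; apply: (no_out true).
  + move=> v v1 [d [cd dv]].
    have v0 : v != s0 by apply: contraTneq cd => v0; rewrite c0 // dv.
    by rewrite -(outs true v v0 v1); apply: eq_card => e; rewrite !inE; case: (c e).
  + move=> v [d [cd dv]]; apply: (conn true) => [e|]; first by case: (c e).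
    by apply: contraTneq cd => v0; rewrite c0 // dv.
Qed.

End Decomposition.

Definition decomposition_of_labeling (L : {ffun D -> bool}) :
    {ffun D -> bool} * {ffun D -> bool} :=
  ([ffun d => if col (tail d) then L ((sigma^-1)%g d) else L d],
   [ffun d => L d != L ((sigma^-1)%g d)]).

(** In the [turn]-order, the corner [d] comes just before [sigma d] at a black vertex and just
    before [d] at a white one. *)
Definition labeling_of_decomposition (co : {ffun D -> bool} * {ffun D -> bool}) :
    {ffun D -> bool} :=
  [ffun d => if col (tail d) then co.1 (sigma d) else co.1 d].

Lemma labelingK : cancel decomposition_of_labeling labeling_of_decomposition.
Proof.
move=> L; apply/ffunP => d; rewrite !ffunE /= (tail_sigma planeM).
by case cd: (col _); rewrite ?cd ?permK.
Qed.

Lemma decompositionK (co : {ffun D -> bool} * {ffun D -> bool}) : local_decomposition co.1 co.2 ->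
  decomposition_of_labeling (labeling_of_decomposition co) = co.
Proof.
case: co => c out [/= _ outE _ _ _]; congr pair; apply/ffunP => d.
  rewrite !ffunE /= (tail_sigmaV planeM).
  by case cd: (col _); rewrite ?permKV.
rewrite !ffunE /= (tail_sigmaV planeM) outE /turn.
by case: (col _); rewrite ?permKV // eq_sym.
Qed.

(** At a black vertex the word is shifted by one; at a white vertex it is reversed, which exchanges
    rises and falls. *)
Lemma card_rises_sigma (L : D -> bool) v :
  #|rises tail rho (fun d => if col (tail d) then L ((sigma^-1)%g d) else L d) v|
  = #|rises tail sigma L v|.
Proof.
have tailE d e : fconnect sigma d e = (tail d == tail e) by case: planeM => _ ->.
have sI : injective sigma by apply: perm_inj.
case cv: (col v).
  have -> : rises tail sigma L v = rises tail sigma ((L \o (sigma^-1)%g) \o sigma) v.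
    by apply/setP => d; rewrite !inE /= !permK.
  rewrite (card_rises_comp tailE sI); apply: eq_card => d; rewrite !inE (tail_turn _ planeM).
  by case: eqP => //= dv; rewrite /turn dv cv.
rewrite -(card_risesN tailE sI) -(card_preimset _ sI); apply: eq_card => d.
rewrite !inE (tail_turn _ planeM) (tail_sigma planeM); case: eqP => //= dv.
by rewrite /turn (tail_sigma planeM) dv cv permK negbK andbC.
Qed.

Lemma labeling_local (L : {ffun D -> bool}) : strong_labeling alpha sigma tail o s0 s1 L ->
  local_decomposition (decomposition_of_labeling L).1 (decomposition_of_labeling L).2.
Proof.
move=> /strong_labelingE[L0 L1 r1 alt]; split=> [d|d|d d0|d d1|v v0 v1].
- have phiV : phi ((sigma^-1)%g d) = alpha d by rewrite /Defs.phi permKV.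
  have phiA : phi ((sigma^-1)%g (alpha d)) = d by rewrite /Defs.phi permKV (alphaK planeM).
  have := alt ((sigma^-1)%g d); have := alt ((sigma^-1)%g (alpha d)).
  rewrite phiV phiA !(tail_sigmaV planeM) !ffunE (col_alpha colP) => -> ->.
  by do 2!case: (L _); case: (col _).
- rewrite !ffunE (tail_turn _ planeM) /turn.
  by case: (col _); rewrite ?permK // eq_sym.
- by rewrite ffunE d0 col0 L0 // (tail_sigmaV planeM).
- by rewrite ffunE d1 col1 L1 // (tail_sigmaV planeM).
- rewrite -(r1 v v0 v1) -(card_rises_sigma L); apply: eq_card => d.
  by rewrite !inE !ffunE.
Qed.

Lemma local_labeling (co : {ffun D -> bool} * {ffun D -> bool}) :
  local_decomposition co.1 co.2 ->
  strong_labeling alpha sigma tail o s0 s1 (labeling_of_decomposition co).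
Proof.
case=> ca outE c0 c1 r1; apply/strong_labelingE; split=> [d d0|d d1|v v0 v1|d].
- by rewrite ffunE d0 col0 c0 // (tail_sigma planeM).
- by rewrite ffunE d1 col1 c1 // (tail_sigma planeM).
- rewrite -(r1 v v0 v1) -card_rises_sigma; apply: eq_card => d.
  rewrite !inE !ffunE (tail_turn _ planeM) !(tail_sigmaV planeM) (tail_turn _ planeM).
  by case: (col (tail d)); rewrite ?permKV.
rewrite !ffunE col_phi /Defs.phi; have [cE oE] := ca (sigma d).
rewrite cE; case cd: (col (tail d)) => /=; first by case: (co.1 _).
(* White case: the edge of [sigma d] leaves exactly one of its ends, so the color changes after
   exactly one of its two darts. *)
move: oE; rewrite !outE cE /turn (col_alpha colP) (tail_sigma planeM) cd /= permK.
by do 3!case: (co.1 _).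
Qed.

End Quadrangulation.

Theorem theorem22 (D V : finType) (alpha : D -> D) (sigma : {perm D})
    (tail : D -> V) (col : V -> bool) (o : D) (s0 s1 : V) :
  quadrangulation alpha sigma tail ->
  proper_coloring alpha tail col ->
  col s0 -> col s1 -> s0 != s1 ->
  on_face alpha sigma tail o s0 -> on_face alpha sigma tail o s1 ->
  exists f : {L : {ffun D -> bool} | strong_labeling alpha sigma tail o s0 s1 L} ->
             {co : {ffun D -> bool} * {ffun D -> bool} |
                separating_decomposition alpha sigma tail col s0 s1 co.1 co.2},
    bijective f.
Proof.
move=> quadM colP col0 col1 s01 face0 face1.
have toD (L : {ffun D -> bool}) : strong_labeling alpha sigma tail o s0 s1 L ->
    separating_decomposition alpha sigma tail col s0 s1
      (decomposition_of_labeling sigma tail col L).1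
      (decomposition_of_labeling sigma tail col L).2.
  move/(labeling_local quadM colP col0 col1 face0).
  exact: (local_decompositionP quadM colP col0 col1 face0 face1).
have toL (co : {ffun D -> bool} * {ffun D -> bool}) :
    separating_decomposition alpha sigma tail col s0 s1 co.1 co.2 ->
    local_decomposition alpha sigma tail col s0 s1 co.1 co.2.
  exact: (decomposition_local quadM s01).
exists (fun L => exist _ (decomposition_of_labeling sigma tail col (sval L)) (toD _ (svalP L))).
exists (fun co => exist _ (labeling_of_decomposition sigma tail col (sval co))
  (local_labeling quadM colP col0 col1 face0 (toL _ (svalP co)))).
  by move=> [L HL]; apply: subset_eq_compat; apply: (labelingK col quadM).
by move=> [co Hco]; apply: subset_eq_compat; apply: (decompositionK quadM (toL _ Hco)).
Qed.
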